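(* There is a universal constant $c>0$ such that the following holds. For any integer $T>c$ and integers $n,d$ with $d>cT$ and $n>cT^2\log(T)$, for every deterministic algorithm that interacts for $T$ rounds with the two-sided oracle and then outputs $\mathbf{w}_{T+1}\in\mathbb{R}^d$, there exists a matrix $A\in[-1,+1]^{n\times d}$ satisfying \[ \max_{\mathbf{w}\in\mathbb{R}^d:\|\mathbf{w}\|_1\le1}\ \min_{\mathbf{p}\in\Delta^{n-1}}\mathbf{p}^\top A\mathbf{w}\ \ge\ \frac{1}{c\log(d)\sqrt{\log(n)}}\cdot\frac{1}{T^2\sqrt{T}}, \] yet the algorithm's output after $T$ rounds of interaction with $\mathcal{O}_2^A$ satisfies $\min_{\mathbf{p}\in\Delta^{n-1}}\mathbf{p}^\top A\mathbf{w}_{T+1}\le0$.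
   Context: $\Delta^{n-1}$ is the probability simplex in $\mathbb{R}^n$; $\log$ is the natural logarithm. The two-sided oracle $\mathcal{O}_2^A$: given $(\mathbf{p},\mathbf{w})\in\mathbb{R}^n\times\mathbb{R}^d$ (arbitrary vectors), returns $A\mathbf{w}$ and $\mathbf{p}^\top A$. A deterministic algorithm chooses its query $(\mathbf{p}_t,\mathbf{w}_t)$ at round $t$ as a deterministic function of responses from rounds $1,\dots,t-1$, and after round $T$ outputs $\mathbf{w}_{T+1}\in\mathbb{R}^d$ as a deterministic function of all responses. *)

(* Defs.v *)
From HB Require Import structures.
From mathcomp Require Import all_boot all_order all_algebra.
From mathcomp Require Import reals exp.
Set Implicit Arguments. Unset Strict Implicit. Unset Printing Implicit Defensive.
Import Order.TTheory GRing.Theory Num.Theory.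
Local Open Scope ring_scope.

Section Defs.
Variable R : realType.

Definition in_simplex (n : nat) (p : 'cV[R]_n) : Prop :=
  (forall i, 0 <= p i 0) /\ \sum_(i < n) p i 0 = 1.

Definition l1norm (d : nat) (w : 'cV[R]_d) : R := \sum_(j < d) `|w j 0|.

Definition entries_in_unit (n d : nat) (A : 'M[R]_(n, d)) : Prop :=
  forall i j, -1 <= A i j <= 1.

Definition query_t (n d : nat) := ('cV[R]_n * 'cV[R]_d)%type.
Definition resp_t (n d : nat) := ('cV[R]_n * 'rV[R]_d)%type.

Definition oracle2 (n d : nat) (A : 'M[R]_(n, d)) (q : query_t n d)
  : resp_t n d := (A *m q.2, q.1^T *m A).

(* A deterministic algorithm: the query of round t is a function of the
   responses of rounds 1..t-1 (the round index is the length of the history);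
   the final output is a function of all responses. *)
Record algorithm (n d : nat) := Algorithm {
  alg_query : seq (resp_t n d) -> query_t n d;
  alg_output : seq (resp_t n d) -> 'cV[R]_d }.

Fixpoint history (n d : nat) (A : 'M[R]_(n, d)) (alg : algorithm n d)
  (t : nat) : seq (resp_t n d) :=
  match t with
  | 0 => [::]
  | t'.+1 => let h := history A alg t' in
             rcons h (oracle2 A (alg_query alg h))
  end.

Definition alg_result (n d : nat) (A : 'M[R]_(n, d)) (alg : algorithm n d)
  (T : nat) : 'cV[R]_d := alg_output alg (history A alg T).

Definition bilin (n d : nat) (p : 'cV[R]_n) (A : 'M[R]_(n, d)) (w : 'cV[R]_d)
  : R := (p^T *m A *m w) 0 0.

End Defs.

(* Main.v *)
Require Import Defs.
From HB Require Import structures.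
From mathcomp Require Import all_boot all_order all_algebra.
From mathcomp Require Import reals exp.
From mathcomp Require Import ring lra zify.
Import Order.TTheory GRing.Theory Num.Theory.

Set Implicit Arguments. Unset Strict Implicit. Unset Printing Implicit Defensive.
Local Open Scope ring_scope.

(**
The adversary builds A as b * sum_{s <= T+1} (y_s - y_{s-1}) e_s^T with y_0 = 0,
y_{T+1} = (1,...,1) and orthonormal e_s, where e_s is chosen after the query w_s
and orthogonal to w_1, ..., w_s, so that A (e_1 + ... + e_{T+1}) = b (1,...,1).
The vector y_s is chosen after p_s with p_k^T y_s = p_k^T (1,...,1) for all
k <= s; hence later summands are invisible to the first s rounds.  Taking y_s to
be a vertex of the polytope cut out by these s equations, sum_i y_i = n and
0 <= y_i <= 2T, at most n/(2T) + s + 1 of its entries are nonzero.  The supports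
of y_1, ..., y_T therefore miss some row i, and e_{T+1} is orthogonal to the
output, so the output scores 0 on row i.  The rows of A have Euclidean norm at
most 2Tb sqrt(T+1), which dictates b.
*)

(** * Linear algebra: kernel vectors with prescribed support, and sparse points of a box *)

Lemma left_kernel_supported (F : fieldType) (n k : nat) (S : {set 'I_n})
    (B : 'M[F]_(n, k)) :
  (\rank B < #|S|)%N ->
  exists u : 'rV[F]_n,
    [/\ u != 0, u *m B = 0 & forall j, j \notin S -> u 0 j = 0].
Proof.
move=> rkB.
pose J : 'M[F]_(#|S|, n) := \matrix_(i, j) (enum_val i == j)%:R.
have : kermx (J *m B) != 0.
  rewrite -mxrank_eq0 mxrank_ker subn_eq0 -ltnNge.
  exact: leq_ltn_trans (mxrankM_maxr _ _) rkB.
case/rowV0Pn=> f /sub_kermxP fJB f0.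
exists (f *m J); split; last 2 first.
- by rewrite -mulmxA.
- move=> j jS; rewrite mxE big1 // => i _; rewrite mxE.
  case: eqP => [ij|_]; last by rewrite mulr0.
  by rewrite -ij enum_valP in jS.
apply: contra f0 => /eqP fJ; apply/eqP/rowP => i.
have /rowP /(_ (enum_val i)) := fJ; rewrite !mxE (bigD1 i) //= big1 => [|l li].
  by rewrite mxE eqxx mulr1 addr0.
by rewrite mxE (inj_eq enum_val_inj) (negbTE li) mulr0.
Qed.

(* A fractional set larger than the number of equations supports a kernel
   vector of [C]; moving along it until the boundary of the box is hit makes
   one more coordinate integral. *)
Lemma box_vertex (F : realFieldType) (k n : nat) (C : 'M[F]_(k, n)) (b : F)
    (y0 : 'cV[F]_n) :
  (forall i, 0 <= y0 i 0 <= b) ->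
  exists y : 'cV[F]_n,
    [/\ C *m y = C *m y0, forall i, 0 <= y i 0 <= b
      & (#|[set i | (0 < y i 0 < b)%R]| <= k)%N].
Proof.
have [m] := ubnP #|[set i | 0 < y0 i 0 < b]|.
elim: m y0 => // m IHm y0 card_m y0_box.
pose frac := [set i | 0 < y0 i 0 < b].
have [le_k|gt_k] := leqP #|frac| k; first by exists y0.
have rkC : (\rank C^T < #|frac|)%N by apply: leq_ltn_trans gt_k; rewrite rank_leq_col.
have [u [u0 uC u_supp]] := left_kernel_supported rkC.
have [i0 ui0] : exists i, u 0 i != 0.
  by apply/rV0Pn.
(* [ratio i] is the step length along [u] at which coordinate [i] reaches the boundary of the box;
   the smallest one keeps every coordinate inside. *)
pose ratio i := if 0 < u 0 i then (b - y0 i 0) / u 0 i else y0 i 0 / - u 0 i.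
have [i1 /= ui1 min_i1] := @arg_minP _ F 'I_n i0 (fun i => u 0 i != 0) ratio ui0.
pose a := ratio i1.
have fracP i : u 0 i != 0 -> 0 < y0 i 0 < b.
  move=> ui; have : i \in frac by apply: contraNT ui => /u_supp ->.
  by rewrite inE.
have a_gt0 : 0 < a.
  have /andP[y_gt0 y_lt] := fracP _ ui1.
  rewrite /a /ratio; case: (ltrP 0 (u 0 i1)) => u_gt0; first by rewrite divr_gt0 ?subr_gt0.
  by rewrite divr_gt0 // oppr_gt0 lt_neqAle ui1.
pose y := y0 + a *: u^T.
have yE i : y i 0 = y0 i 0 + a * u 0 i by rewrite !mxE.
have Cy : C *m y = C *m y0.
  by rewrite mulmxDr -scalemxAr -[C]trmxK -trmx_mul uC trmx0 scaler0 addr0.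
have y_box i : 0 <= y i 0 <= b.
  rewrite yE; have [->|ui] := eqVneq (u 0 i) 0; first by rewrite mulr0 addr0.
  have /andP[y_gt0 y_lt] := fracP _ ui.
  have := min_i1 _ ui; rewrite -/a /ratio; case: (ltrP 0 (u 0 i)) => u_gt0.
    by rewrite ler_pdivlMr // => au; nra.
  have u_lt0 : 0 < - u 0 i by rewrite oppr_gt0 lt_neqAle ui.
  by rewrite ler_pdivlMr // => au; nra.
have y_i1 : ~~ (0 < y i1 0 < b).
  rewrite yE /a /ratio; case: (ltrP 0 (u 0 i1)) => u_gt0.
    by rewrite divfK // addrC subrK ltxx andbF.
  by rewrite invrN mulrN mulNr divfK // subrr ltxx.
have sub : [set i | 0 < y i 0 < b] \subset frac :\ i1.
  apply/subsetP => i; rewrite !inE => yi; apply/andP; split.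
    by apply: contraNneq y_i1 => <-.
  have [ui|/fracP //] := eqVneq (u 0 i) 0.
  by move: yi; rewrite yE ui mulr0 addr0.
have [|y' [Cy' y'_box y'_card]] := IHm y _ y_box.
  apply: leq_ltn_trans (subset_leq_card sub) _.
  by rewrite (cardsD1 i1) inE (fracP _ ui1) in card_m.
by exists y'; rewrite Cy' Cy.
Qed.

Lemma sparse_box_solution (F : realFieldType) (k n m : nat)
    (C : 'M[F]_(k, n)) :
  (0 < m)%N ->
  exists y : 'cV[F]_n,
    [/\ C *m y = C *m const_mx 1, forall i, 0 <= y i 0 <= m%:R
      & (#|[set i | (y i 0 != 0)%R]| * m <= n + k.+1 * m)%N].
Proof.
move=> m_gt0.
have one_box (i : 'I_n) : 0 <= (const_mx 1 : 'cV[F]_n) i 0 <= m%:R.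
  by rewrite mxE ler01 ler1n.
(* The extra all-ones equation fixes the sum, hence bounds the number of
   coordinates saturated at [m]. *)
have [y [Cy y_box y_card]] := box_vertex (col_mx (const_mx 1 : 'rV_n) C) one_box.
move: Cy; rewrite !mul_col_mx => /eq_col_mx [ysum Cy].
exists y; split=> //.
pose full := [set i | y i 0 == m%:R].
have full_card : (#|full| * m <= n)%N.
  have sumy : \sum_i y i 0 = n%:R.
    have /rowP /(_ 0) := ysum; rewrite !mxE.
    under eq_bigr do rewrite mxE mul1r.
    by under [RHS]eq_bigr do rewrite !mxE mul1r; rewrite sumr_const card_ord.
  rewrite -(ler_nat F) natrM -sumy mulr_natl -sumr_const.
  rewrite [leRHS](bigID (mem full)) /=; apply: ler_wpDr.
    by apply: sumr_ge0 => i _; case/andP: (y_box i).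
  by apply: ler_sum => i; rewrite inE => /eqP ->.
have sub : [set i | y i 0 != 0] \subset full :|: [set i | 0 < y i 0 < m%:R].
  apply/subsetP => i; rewrite !inE => yi; case/andP: (y_box i) => y0 ym.
  by rewrite lt0r yi y0 /= lt_neqAle ym andbT orbN.
have le_card : (#|[set i | (y i 0 != 0)%R]| <= #|full| + k.+1)%N.
  apply: leq_trans (subset_leq_card sub) _.
  by apply: leq_trans (leq_card_setU _ _) _; rewrite leq_add2l.
apply: leq_trans (leq_mul le_card (leqnn m)) _.
by rewrite mulnDl leq_add2r.
Qed.

Lemma unit_vector_supported (F : rcfType) (d k : nat) (S : {set 'I_d})
    (B : 'M[F]_(d, k)) :
  (\rank B < #|S|)%N ->
  exists e : 'rV[F]_d,
    [/\ \sum_j e 0 j ^+ 2 = 1, e *m B = 0 & forall j, j \notin S -> e 0 j = 0].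
Proof.
move=> /left_kernel_supported [u [u0 uB u_supp]].
pose s := \sum_j u 0 j ^+ 2.
have s_gt0 : 0 < s.
  have /rV0Pn [i ui] := u0.
  rewrite /s (bigD1 i) //= ltr_pwDl // ?sumr_ge0 // => [|j _].
    by rewrite exprn_even_gt0.
  by rewrite sqr_ge0.
exists ((Num.sqrt s)^-1 *: u); split.
- under eq_bigr do rewrite mxE exprMn.
  by rewrite -mulr_sumr exprVn sqr_sqrtr ?ltW // mulVf // gt_eqF.
- by rewrite -scalemxAl uB scaler0.
- by move=> j /u_supp uj; rewrite mxE uj mulr0.
Qed.

(** * The adversary and its invariant *)

Section Adversary.
Variables (R : realType) (n d : nat) (alg : algorithm R n d).
Implicit Types (M D : 'M[R]_(n, d)) (y : 'cV[R]_n) (v : 'cV[R]_d).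
Implicit Types (S : {set 'I_d}).

Definition query M k := alg_query alg (history M alg k).

(** Induction on rounds: as long as the histories agree, the queries are those made against [M], and
    [D] contributes nothing to either response. *)
Lemma history_unchanged M D t :
  (forall k, (k < t)%N -> (query M k).1^T *m D = 0 /\ D *m (query M k).2 = 0) ->
  history (M + D) alg t = history M alg t.
Proof.
elim: t => //= t IHt D0.
rewrite IHt => [|k kt]; last exact/D0/ltnW.
have [pD Dw] := D0 t (ltnSn t).
by rewrite /oracle2 mulmxDl mulmxDr Dw pD !addr0.
Qed.

(* The state after [t] of [T] rounds: [M] is the partial sum of the [t] summands
   chosen so far, [y] is [y_t], [v] is [e_1 + ... + e_t], and [S] is a set of
   coordinates supporting all the [e_s], which keeps the l1-norm of [v] independent of
   [d]. *)
Record resisting (m T : nat) (b : R) S (t : nat) M y v : Prop :=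
  Resisting {
    resisting_dual : forall k, (k < t)%N ->
      (query M k).1^T *m y = (query M k).1^T *m const_mx 1;
    resisting_box : forall i, 0 <= y i 0 <= m%:R;
    resisting_primal : M *m v = b *: y;
    resisting_norm : \sum_j v j 0 ^+ 2 = t%:R;
    resisting_supp : forall j, j \notin S -> v j 0 = 0;
    resisting_rank : (\rank M <= t)%N;
    resisting_row : forall i, \sum_j M i j ^+ 2 <= (b * m%:R) ^+ 2 *+ t;
    resisting_card :
      (#|[set i | (row i M != 0)%R]| * m <= t * (n + T.+1 * m))%N }.

Lemma resisting0 m T b S : resisting m T b S 0 0 0 0.
Proof.
split=> //.
- by move=> i; rewrite mxE lexx ler0n.
- by rewrite mul0mx scaler0.
- by rewrite big1 // => j _; rewrite mxE expr0n.
- by move=> j _; rewrite mxE.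
- by rewrite mxrank0.
- by move=> i; rewrite big1 // => j _; rewrite mxE expr0n.
- rewrite (_ : [set i | _] = set0) ?cards0 //.
  by apply/setP => i; rewrite !inE row0 eqxx.
Qed.

(** All the orthogonality conditions together have rank at most [t + t + 2]: [M] counts by its rank
    [t], not by its [n] rows, the past queries give [t], and [v] and [wlast] one each. *)
Lemma fresh_direction M v S t (wlast : 'cV[R]_d) :
  (\rank M <= t)%N -> (t + t + 2 < #|S|)%N ->
  exists e : 'rV[R]_d,
    [/\ \sum_j e 0 j ^+ 2 = 1, M *m e^T = 0, e *m v = 0 &
        [/\ e *m wlast = 0,
            forall k, (k < t)%N -> e *m (query M k).2 = 0
          & forall j, j \notin S -> e 0 j = 0]].
Proof.
move=> rkM cardS.
pose W : 'M[R]_(d, t) := \matrix_(j, k) (query M k).2 j 0.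
pose B := row_mx M^T (row_mx W (row_mx v wlast)).
have rkB : (\rank B < #|S|)%N.
  apply: leq_ltn_trans cardS.
  rewrite -mxrank_tr /B tr_row_mx -addsmxE -addnA.
  apply: leq_trans (mxrank_adds_leqif _ _) _.
  by rewrite leq_add ?trmxK // rank_leq_row.
have [e [e1 eB eS]] := unit_vector_supported rkB.
move: eB; rewrite !mul_mx_row -!row_mx0.
move=> /eq_row_mx [eM /eq_row_mx [eW /eq_row_mx [ev ew]]].
exists e; split=> //; first by rewrite -[M]trmxK -trmx_mul eM trmx0.
split=> // k kt.
have /rowP /(_ (Ordinal kt)) := eW; rewrite !mxE => eWk.
by apply/rowP => i; rewrite !ord1 !mxE -[RHS]eWk; apply: eq_bigr => j _; rewrite mxE.
Qed.

(** The vector [y'] stays free because the lemma serves twice: with a sparse [y'] and the current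
    query as [wlast] in each round, then with the all-ones vector and the output as [wlast] at the
    end. *)
Lemma resisting_extend m T b S t M y v (wlast : 'cV[R]_d) :
  resisting m T b S t M y v -> (t + t + 2 < #|S|)%N ->
  exists e : 'rV[R]_d,
    [/\ \sum_j e 0 j ^+ 2 = 1, e *m wlast = 0, forall j, j \notin S -> e 0 j = 0 &
     forall y', (forall i, 0 <= y' i 0 <= m%:R) ->
      (forall k, (k < t)%N ->
        (query M k).1^T *m y' = (query M k).1^T *m const_mx 1) ->
      let M' := M + b *: ((y' - y) *m e) in let v' := v + e^T in
      [/\ forall k, (k <= t)%N -> history M' alg k = history M alg k,
          M' *m v' = b *: y', \sum_j v' j 0 ^+ 2 = t.+1%:R &
          forall i, \sum_j M' i j ^+ 2 <= (b * m%:R) ^+ 2 *+ t.+1]].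
Proof.
case=> dual box primal norm supp rk rows _ cardS.
have [e [e1 Me ev [ew eW eS]]] := fresh_direction v wlast rk cardS.
exists e; split=> // y' box' dual' M' v'.
have e_v : \sum_j v j 0 * e 0 j = 0.
  have /rowP /(_ 0) := ev; rewrite !mxE => ev0; rewrite -[RHS]ev0.
  by apply: eq_bigr => j _; rewrite mulrC.
have eeT : e *m e^T = 1%:M.
  apply/rowP => i; rewrite !ord1 !mxE -[RHS]e1.
  by apply: eq_bigr => j _; rewrite mxE expr2.
split.
- move=> k kt; apply: history_unchanged => l lk.
  have lt : (l < t)%N := leq_trans lk kt.
  rewrite -scalemxAr mulmxA mulmxBr dual' // dual // subrr mul0mx scaler0.
  by rewrite -scalemxAl -mulmxA eW // mulmx0 scaler0.
- rewrite /M' /v' mulmxDl !mulmxDr primal Me addr0 -!scalemxAl -!mulmxA ev.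
  by rewrite eeT mulmx0 scaler0 add0r mulmx1 -scalerDr addrC subrK.
- rewrite /v' -natr1 -norm -[X in _ = _ + X]e1.
  under eq_bigr do rewrite !mxE sqrrD.
  by rewrite !big_split /= e_v !addr0.
(* Pythagoras: [e] is orthogonal to row [i] of [M], and [y i 0] and [y' i 0] differ by at most
   [m]. *)
- move=> i; rewrite mulrSr.
  pose c := b * (y' i 0 - y i 0).
  have M'E j : M' i j = M i j + c * e 0 j.
    by rewrite !mxE big_ord1 !mxE mulrA.
  have Me_i : \sum_j M i j * (c * e 0 j) = 0.
    have /colP /(_ i) := Me; rewrite !mxE => Me0.
    rewrite -[RHS](mulr0 c) -[in RHS]Me0 mulr_sumr.
    by apply: eq_bigr => j _; rewrite mxE mulrCA.
  under eq_bigr do rewrite M'E sqrrD exprMn.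
  rewrite !big_split /= Me_i !addr0 -mulr_sumr e1 mulr1.
  apply: lerD => //; rewrite /c !exprMn ler_wpM2l ?sqr_ge0 //.
  have := box i; have := box' i; nra.
Qed.

Lemma resistingS m T b S t M y v :
  (0 < m)%N -> (t < T)%N -> (t + t + 2 < #|S|)%N ->
  resisting m T b S t M y v ->
  exists M' y' v', resisting m T b S t.+1 M' y' v'.
Proof.
move=> m_gt0 tT cardS res.
have [e [_ ew eS extend]] := resisting_extend (query M t).2 res cardS.
pose C : 'M[R]_(t.+1, n) := \matrix_(k, i) (query M k).1 i 0.
have [y' [Cy' box' card']] := sparse_box_solution C m_gt0.
have dual' k : (k < t.+1)%N ->
    (query M k).1^T *m y' = (query M k).1^T *m const_mx 1.
  move=> kt; have /(congr1 (row (Ordinal kt))) := Cy'.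
  rewrite !row_mul (_ : row _ C = (query M k).1^T) //.
  by apply/rowP => i; rewrite !mxE.
have [hist primal' norm' rows'] := extend y' box' (fun k kt => dual' k (ltnW kt)).
case: res => dual box primal norm supp rk rows card.
exists (M + b *: ((y' - y) *m e)), y', (v + e^T); split=> //.
- by move=> k kt; rewrite /query hist //; apply: dual'.
- by move=> j jS; rewrite !mxE supp // eS // addr0.
- apply: leq_trans (mxrank_add _ _) _; rewrite -[t.+1]addn1 leq_add //.
  apply: leq_trans (mxrank_scale _ _) _.
  exact: leq_trans (mxrankM_maxr _ _) (rank_leq_row _).
- have sub : [set i | row i (M + b *: ((y' - y) *m e)) != 0] \subset
      [set i | row i M != 0] :|: [set i | y' i 0 != 0].
    apply/subsetP => i; rewrite !inE -negb_and; apply: contra => /andP[Mi yi].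
    (* No separate count for the support of [y] is needed: by [M *m v = b *: y], a zero row of [M]
       already forces [b * y i 0 = 0]. *)
    have byi : b * y i 0 = 0.
      have /colP /(_ i) := primal; rewrite !mxE => Mv; rewrite -[LHS]Mv.
      have /eqP/rowP rMi := Mi; rewrite big1 // => j _.
      by have := rMi j; rewrite !mxE => ->; rewrite mul0r.
    apply/eqP/rowP => j; have /eqP/rowP /(_ j) := Mi; rewrite !mxE => ->.
    by rewrite add0r big_ord1 !mxE (eqP yi) mulrA add0r mulrN byi oppr0 mul0r.
  have le_card := leq_trans (subset_leq_card sub) (leq_card_setU _ _).
  apply: leq_trans (leq_mul le_card (leqnn m)) _.
  rewrite mulnDl mulSn addnC leq_add //.
  by apply: leq_trans card' _; rewrite leq_add2l leq_mul2r ltnS tT orbT.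
Qed.

Lemma resisting_exists m T b S t :
  (0 < m)%N -> (t <= T)%N -> (T + T < #|S|)%N ->
  exists M y v, resisting m T b S t M y v.
Proof.
move=> m_gt0 + cardS; elim: t => [_|t IHt tT].
  by exists 0, 0, 0; apply: resisting0.
have [M [y [v res]]] := IHt (ltnW tT).
by apply: resistingS res => //; lia.
Qed.
End Adversary.

(** * Numerical estimates and the choice of parameters *)

Lemma ln_ge1 (R : realType) (x : R) : 4 <= x -> 1 <= ln x.
Proof.
move=> x4; apply: (@le_trans _ _ (ln (4 : R))); last first.
  by rewrite ler_ln // posrE; lra.
(* In this form, [ln (1 + x) <= x] at [x = - 1/2] yields [ln 4 >= 1]. *)
have -> : (4 : R) = (1 + - 2^-1) ^- 2 by field.
rewrite -exprVn lnXn ?lnV ?posrE ?invr_gt0; try lra.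
have : ln (1 + - 2^-1 : R) <= - 2^-1 by apply: le_ln1Dx; lra.
rewrite -[_ *+ 2]mulr_natr; lra.
Qed.

(** Termwise [2 |x| <= x^2 + 1] on [S]. *)
Lemma sum_normr_supported (F : realFieldType) (I : finType) (S : {set I})
    (v : I -> F) :
  (forall j, j \notin S -> v j = 0) ->
  \sum_j `|v j| <= (\sum_j v j ^+ 2 + #|S|%:R) / 2.
Proof.
move=> v_supp.
have -> : #|S|%:R = \sum_j (if j \in S then 1 else 0) :> F.
  by rewrite -big_mkcond sumr_const.
rewrite -big_split mulr_suml; apply: ler_sum => j _ /=.
case: ifPn => [_|/v_supp ->]; last by rewrite normr0 expr0n /= addr0 mul0r.
by rewrite -real_normK ?num_real //; have := sqr_ge0 (`|v j| - 1); nra.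
Qed.

Theorem theorem3 (R : realType) :
  exists c : R, 0 < c /\
  forall (T n d : nat),
    c < T%:R ->
    c * T%:R < d%:R ->
    c * (T%:R ^+ 2) * ln (T%:R) < n%:R ->
    forall alg : algorithm R n d,
    exists A : 'M[R]_(n, d),
      entries_in_unit A /\
      (exists w : 'cV[R]_d, l1norm w <= 1 /\
         forall p : 'cV[R]_n, in_simplex p ->
           (c * ln (d%:R) * Num.sqrt (ln (n%:R)))^-1
             * (T%:R ^+ 2 * Num.sqrt (T%:R))^-1 <= bilin p A w) /\
      (exists p : 'cV[R]_n, in_simplex p /\ bilin p A (alg_result A alg T) <= 0).
Proof.
exists 8; split=> // T n d T_gt d_gt n_gt alg.
have T8 : (8 < T)%N by rewrite -(ltr_nat R).
have d8 : (8 * T < d)%N by rewrite -(ltr_nat R) natrM.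
have lnT : 1 <= ln T%:R :> R by apply: ln_ge1; lra.
have n8 : (8 * T ^ 2 < n)%N.
  rewrite -(ltr_nat R) natrM natrX; apply: le_lt_trans n_gt.
  by rewrite ler_peMr // mulr_ge0 // exprn_ge0.
have lnd : 1 <= ln d%:R :> R by apply: ln_ge1; rewrite ler_nat; lia.
have lnn : 1 <= ln n%:R :> R by apply: ln_ge1; rewrite ler_nat; nia.
(* With [m = 2T] the nonzero rows of [M] number at most [n/2 + T(T+1)], which is below [n] since
   [n > 8 T^2]. *)
pose m := (2 * T)%N.
pose q : R := Num.sqrt T.+1%:R.
have q_gt0 : 0 < q by rewrite sqrtr_gt0.
have q2 : q ^+ 2 = T.+1%:R by rewrite sqr_sqrtr.
have m_gt0 : 0 < m%:R :> R by rewrite ltr0n; lia.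
(* This makes the bound [(b m)^2 (T+1)] on the squared row norms of [A] equal to 1. *)
pose b : R := (m%:R * q)^-1.
have b_gt0 : 0 < b by rewrite invr_gt0 mulr_gt0.
(* The last extension, at [t = T], needs more than [2T + 2] coordinates. *)
pose S := [set j : 'I_d | (j < T + T + 3)%N].
have cardS : #|S| = (T + T + 3)%N.
  have leS : (T + T + 3 <= d)%N by lia.
  have widen_inj : injective (widen_ord leS).
    by move=> j k /(congr1 val) /= /val_inj.
  rewrite -[RHS]card_ord -(card_imset _ widen_inj).
  apply: eq_card => j; rewrite inE; apply/idP/imsetP => [jS|[k _ ->]].
    by exists (Ordinal jS) => //; apply: val_inj.
  exact: (ltn_ord k).
have mT : (0 < m)%N by rewrite /m; lia.
have [M [y [v res]]] : exists M y v, resisting alg m T b S T M y v.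
  by apply: resisting_exists => //; rewrite cardS; lia.
pose wlast := alg_output alg (history M alg T).
have [|e [e1 ew eS extend]] := resisting_extend wlast res; first by rewrite cardS; lia.
have [||hist primal norm rows] := extend (const_mx 1) => //.
  by move=> i; rewrite mxE ler01 ler1n.
pose A := M + b *: ((const_mx 1 - y) *m e).
pose u := v + e^T.
exists A; split; last split.
- move=> i j; rewrite -ler_norml -(@expr_le1 _ 2) // real_normK ?num_real //.
  have <- : (b * m%:R) ^+ 2 *+ T.+1 = 1.
    rewrite /b -mulr_natr -q2; field.
    by rewrite !gt_eqF.
  apply: le_trans (rows i); rewrite (bigD1 j) //= lerDl sumr_ge0 // => k _.
  exact: sqr_ge0.
- have T0 : 0 < T%:R :> R by lra.
  (* The l1-norm of [u] is at most [((T+1) + (2T+3)) / 2 <= 2T = m]. *)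
  exists (m%:R^-1 *: u); split.
    rewrite /l1norm; under eq_bigr do rewrite mxE normrM.
    rewrite -mulr_sumr gtr0_norm ?invr_gt0 // ler_pdivrMl // mulr1.
    apply: le_trans (sum_normr_supported (S := S) (v := u^~ 0) _) _.
      by move=> j jS; rewrite !mxE (resisting_supp res) // eS // addr0.
    rewrite norm cardS -natrD ler_pdivrMr // -natrM ler_nat /m; lia.
  move=> p [p_ge0 p1].
  have -> : bilin p A (m%:R^-1 *: u) = m%:R^-1 * b.
    rewrite /bilin -mulmxA -scalemxAr primal -!scalemxAr !mxE.
    rewrite (_ : \sum_j _ = 1) ?mulr1 // -[RHS]p1.
    by apply: eq_bigr => i _; rewrite !mxE mulr1.
  rewrite /b -!invfM lef_pV2 ?posrE ?mulr_gt0 ?exprn_gt0 ?sqrtr_gt0 //; try lra.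
  have q_le : q <= 2 * Num.sqrt T%:R.
    rewrite -(@ler_pXn2r _ 2) ?nnegrE ?mulr_ge0 ?sqrtr_ge0 ?ltW //.
    rewrite q2 exprMn sqr_sqrtr // -[T.+1]addn1 natrD; lra.
  have L : 1 <= ln d%:R * Num.sqrt (ln n%:R) :> R.
    by rewrite mulr_ege1 // -[leLHS]sqrtr1 ler_wsqrtr.
  have s_gt0 : 0 < Num.sqrt T%:R :> R by rewrite sqrtr_gt0.
  (* The value is [1 / (m^2 q)] with [m^2 q <= 4 T^2 * 2 sqrt T], whence the constant 8; the
     logarithmic factors are at least 1 and only weaken the bound. *)
  apply: (@le_trans _ _ (8 * (T%:R ^+ 2 * Num.sqrt T%:R))).
    rewrite /m natrM; have : 0 <= T%:R ^+ 2 :> R by rewrite exprn_ge0.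
    nra.
  rewrite -[8 * ln _ * _]mulrA -[leRHS]mulrA ler_wpM2l // ler_peMl //.
  by rewrite mulr_ge0 ?exprn_ge0 ?ltW.
- have [i Mi] : exists i, row i M = 0.
    have : (#|[set i | row i M != 0%R]| < #|'I_n|)%N.
      have := resisting_card res; rewrite card_ord /m; nia.
    rewrite -cardsT => lt_card.
    have /subsetPn [i _] : ~~ ([set: 'I_n] \subset [set i | row i M != 0]).
      by apply: contraL lt_card => /subset_leq_card; rewrite leqNgt.
    by rewrite inE negbK => /eqP; exists i.
  exists (delta_mx i 0); split; first split.
  + by move=> k; rewrite mxE ler0n.
  + rewrite (bigD1 i) //= big1 => [|k ki]; first by rewrite mxE !eqxx addr0.
    by rewrite mxE (negbTE ki).
  (* [A] and [M] produce the same history, so the output is [wlast]; the last summand vanishes on it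
     and row [i] of [M] is zero. *)
  + rewrite /bilin /alg_result hist // -/wlast trmx_delta -rowE.
    rewrite -row_mul /A [X in row i X]mulmxDl -scalemxAl -mulmxA ew mulmx0 scaler0 addr0.
    by rewrite row_mul Mi mul0mx mxE.
Qed.
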